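(* Let $0<d_1<\cdots<d_k<n$ be integers. The map $$\bigsqcup_{\mathbf{M}\in\mathcal{M}^{d_1,\dots,d_k}_n}\mathcal{F}_{\mathbf{M}}\ \xrightarrow{\ \bigsqcup\mathbb{V}_{\mathbf{M}}\ }\ \mathbb{F}_{d_1<\cdots<d_k}(\mathbb{C}^n)^T,$$ which on each $\mathcal{F}_{\mathbf{M}}$ is given by $\mathbb{V}_{\mathbf{M}}$, is surjective.
   Context: $[n]=\{1,\dots,n\}$ and $\binom{[n]}{d}$ is the set of $d$-element subsets of $[n]$. A matroid of rank $d$ on $n$ elements is a pair $M=([n],\mathcal{B})$ with $\emptyset\neq\mathcal{B}\subset\binom{[n]}{d}$ such that for all $I,J\in\mathcal{B}$ and $i\in I\setminus J$ there is $j\in J\setminus I$ with $(I\setminus\{i\})\cup\{j\}\in\mathcal{B}$. $\mathcal{M}^d_n$ is the set of such matroids, and $\mathcal{M}^{d_1,\dots,d_k}_n=\mathcal{M}^{d_1}_n\times\cdots\times\mathcal{M}^{d_k}_n$; its elements are called plurimatroids. $G(d,n)$ is the Grassmannian of $d$-dimensional subspaces of $\mathbb{C}^n$ (row vectors), with Plücker coordinates $(p_I)_{I\in\binom{[n]}{d}}$. For $M=([n],\mathcal{B})\in\mathcal{M}^d_n$, $G_M=\{W\in G(d,n): p_I(W)\neq0\Leftrightarrow I\in\mathcal{B}\}$. The flag variety is $\mathbb{F}_{d_1<\cdots<d_k}(\mathbb{C}^n)=\{W_1\subset\cdots\subset W_k\subset\mathbb{C}^n:\dim W_i=d_i\}\subset\prod_{i}G(d_i,n)$.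 The thin Schubert cell of $\mathbf{M}=(M_1,\dots,M_k)$ is $\mathbb{F}_{\mathbf{M}}=\left(\prod_{i=1}^kG_{M_i}\right)\cap\mathbb{F}_{d_1<\cdots<d_k}(\mathbb{C}^n)$, an affine locally closed subvariety. $T<\mathrm{GL}_n(\mathbb{C})$ is the torus of invertible diagonal matrices, acting on the right by $(W_1,\dots,W_k)\cdot g=(W_1g,\dots,W_kg)$; each $\mathbb{F}_{\mathbf{M}}$ is $T$-invariant, and all points of a nonempty $\mathbb{F}_{\mathbf{M}}$ have the same isotropy group $\mathrm{Stab}_T(\mathbb{F}_{\mathbf{M}})$. Put $T_{\mathbf{M}}=T/\mathrm{Stab}_T(\mathbb{F}_{\mathbf{M}})$. $\mathcal{F}_{\mathbf{M}}$ denotes the universal geometric quotient (in the sense of Mumford's GIT; it exists) of $\mathbb{F}_{\mathbf{M}}$ by $T_{\mathbf{M}}$, with quotient morphism $\pi:\mathbb{F}_{\mathbf{M}}\to\mathcal{F}_{\mathbf{M}}$; $\mathcal{F}_{\mathbf{M}}=\emptyset$ if $\mathbb{F}_{\mathbf{M}}=\emptyset$. All varieties are viewed as schemes, and points are scheme-theoretic points. $\mathbb{F}_{d_1<\cdots<d_k}(\mathbb{C}^n)^T$ is the set of scheme-theoretic points $\eta$ of the flag variety that are $T$-invariant, i.e. such that $\overline{\{\eta\}}$ is $T$-invariant. The map $\mathbb{V}_{\mathbf{M}}:\mathcal{F}_{\mathbf{M}}\to\mathbb{F}_{d_1<\cdots<d_k}(\mathbb{C}^n)^T$ sends $y$ to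 the point $\eta$ with $\overline{\{\eta\}}=\overline{\pi^{-1}(Y)}$, where $Y=\overline{\{y\}}\subset\mathcal{F}_{\mathbf{M}}$ and the closures of $\{\eta\}$ and $\pi^{-1}(Y)$ are taken in the flag variety (the set $\overline{\pi^{-1}(Y)}$ is $T$-invariant and irreducible, so $\eta$ is its generic point). *)

(* Defs.v *)
From HB Require Import structures.
From mathcomp Require Import all_boot all_order all_algebra.
From mathcomp Require Import all_classical all_reals topology.
From mathcomp Require Import complex.
From mathcomp Require Import -(notations) mpoly.

Set Implicit Arguments.
Unset Strict Implicit.
Unset Printing Implicit Defensive.

Import Order.TTheory GRing.Theory Num.Theory.
Local Open Scope classical_set_scope.
Local Open Scope ring_scope.

Definition set_elt (T : Type) (A : set T) (x : T) (Ax : A x) : A :=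
  exist (fun y => y \in A) x (mem_set Ax).

(** [crd] gives coordinates of the points of [X], and [w v] is the degree in N^k
  of the v-th variable.  With one block of homogeneous coordinates of degree
  [delta_i] for each factor, this is a subset of a product of k projective
  spaces; with [w = 0] every polynomial is homogeneous of degree 0, and this
  is a subset of an affine space. *)

Section ZariskiDefs.
Context (K : numClosedFieldType) (X : choiceType) (N k : nat).
Context (crd : X -> 'I_N -> K) (w : 'I_N -> 'I_k -> nat).

Definition multihomogeneous (e : 'I_k -> nat) (p : mpoly N K) : Prop :=
  forall m, m \in msupp p -> forall i, (\sum_v m v * w v i)%N = e i.

Definition form (e : 'I_k -> nat) (f : X -> K) : Prop :=
  exists2 p, multihomogeneous e p & forall x, f x = meval (crd x) p.

Definition zopen (U : set X) : Prop :=
  exists S : set (X -> K), (forall f, S f -> exists e, form e f) /\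
    U = ~` [set x | forall f, S f -> f x = 0].

Lemma form1 : form (fun=> 0%N) (fun=> 1).
Proof.
exists 1; last by move=> x; rewrite meval1.
move=> m; rewrite msupp1 inE => /eqP -> i.
by rewrite big1 // => v _; rewrite mnm0E mul0n.
Qed.

Lemma formM e1 e2 f1 f2 : form e1 f1 -> form e2 f2 ->
  form (fun i => (e1 i + e2 i)%N) (fun x => f1 x * f2 x).
Proof.
move=> [p1 h1 E1] [p2 h2 E2]; exists (p1 * p2); last first.
  by move=> x; rewrite E1 E2 mevalM.
move=> m /msuppM_le /allpairsP [[m1 m2] /= [/h1 H1 /h2 H2 ->]] i.
rewrite -H1 -H2 -big_split /=; apply: eq_bigr => v _.
by rewrite mnmDE mulnDl.
Qed.

Lemma zopenT : zopen setT.
Proof.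
exists [set fun=> 1]; split => [f ->|]; first by exists (fun=> 0%N); exact: form1.
rewrite eqEsubset; split => // x _ /(_ _ erefl) /eqP.
by rewrite oner_eq0.
Qed.

Lemma zopenI : setI_closed zopen.
Proof.
move=> _ _ [S [hS ->]] [T [hT ->]].
exists [set h | exists f g, [/\ S f, T g & h = fun x => f x * g x]]; split.
  move=> _ [f [g [/hS [e1 he1] /hT [e2 he2] ->]]].
  by exists (fun i => (e1 i + e2 i)%N); exact: formM.
rewrite -setCU; congr (~` _); rewrite eqEsubset; split => x /=.
  move=> [] H _ [f [g [Sf Tg ->]]].
    by rewrite (H _ Sf) mul0r.
  by rewrite (H _ Tg) mulr0.
move=> H; apply: contrapT => /not_orP [/existsNP [f /not_implyP [Sf fx]]].
move=> /existsNP [g /not_implyP [Tg gx]].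
have /eqP := H _ (ex_intro _ f (ex_intro _ g (And3 Sf Tg erefl))).
by rewrite mulf_eq0 => /orP [] /eqP.
Qed.

Lemma zopen_bigU (I : Type) (F : I -> set X) :
  (forall i, zopen (F i)) -> zopen (\bigcup_i F i).
Proof.
move=> /choice [S hS]; exists (\bigcup_i S i); split.
  by move=> f [i _ Sf]; have [/(_ _ Sf)] := hS i.
rewrite eqEsubset; split => x /=.
  move=> [i _]; have [_ ->] := hS i; apply: contra_not => H f Sf.
  by apply: H; exists i.
move=> /existsNP [f /not_implyP [[i _ Sf] fx]]; exists i => //.
by have [_ ->] := hS i => /(_ _ Sf).
Qed.

(** A copy of [X] that remembers [crd] and [w], on which the topology depends. *)
Definition zariski : Type := let _ := (crd, w) in X.
HB.instance Definition _ := Choice.on zariski.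
HB.instance Definition _ :=
  isOpenTopological.Build zariski zopenT zopenI zopen_bigU.

Lemma zopenE : (open : set_system zariski) = zopen.
Proof. by []. Qed.

Definition zregular (U : set zariski) (f : zariski -> K) : Prop :=
  forall x, U x -> exists V : set zariski, [/\ open V, V x &
    exists e p q, [/\ form e p, form e q &
      forall y, V y -> U y -> q y != 0 /\ f y = p y / q y]].

End ZariskiDefs.

(** [regular U f], meant for open [U], says that the restriction of [f] to [U]
  is a section of the structure sheaf; values of [f] outside [U] are junk. *)
Record fspace (K : numClosedFieldType) := FSpace {
  fpoints :> topologicalType;
  regular : set fpoints -> (fpoints -> K) -> Prop }.

Section Varieties.
Context (K : numClosedFieldType).
Implicit Types X Y Z P S : fspace K.

Definition sub_fspace X (A : set X) : fspace K :=
  @FSpace K (set_type A) (fun U f => forall x : A, U x ->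
    exists (V : set X) g, [/\ open V, V (val x), regular V g &
      forall y : A, U y -> V (val y) -> f y = g (val y)]).

Definition morphism X Y (f : X -> Y) : Prop :=
  continuous f /\ forall (U : set Y) g, open U -> regular U g ->
    regular (f @^-1` U) (g \o f).

Definition isomorphic X Y : Prop :=
  exists (f : X -> Y) (g : Y -> X),
    [/\ morphism f, morphism g, cancel f g & cancel g f].

Definition affine_space (m : nat) : fspace K :=
  @FSpace K (zariski (fun (x : 'rV[K]_m) j => x 0 j) (fun _ (_ : 'I_0) => 0%N))
    (@zregular _ _ _ _ _ _).

Definition affine_variety X : Prop :=
  exists m (Z : set (affine_space m)), closed Z /\ isomorphic X (sub_fspace Z).

Definition function_sheaf X : Prop :=
  [/\ forall (U : set X) f g, (forall x, U x -> f x = g x) ->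
        regular U f -> regular U g,
      forall (U V : set X) f, open U -> open V -> V `<=` U ->
        regular U f -> regular V f
    & forall (U : set X) f, open U ->
        (forall x, U x -> exists V : set X,
          [/\ open V, V x, V `<=` U & regular V f]) -> regular U f].

Definition prevariety X : Prop :=
  function_sheaf X /\
  exists (r : nat) (U : 'I_r -> set X),
    [/\ forall j, open (U j), \bigcup_j U j = setT &
        forall j, affine_variety (sub_fspace (U j))].

(** Equivalent to a closed diagonal, without constructing products. *)
Definition separated X : Prop :=
  forall Z (f g : Z -> X), prevariety Z -> morphism f -> morphism g ->
    closed [set z | f z = g z].

Definition variety X : Prop := prevariety X /\ separated X.

Definition fibre_product X Y Z P (f : X -> Z) (g : Y -> Z)
    (p1 : P -> X) (p2 : P -> Y) : Prop :=
  [/\ variety P, morphism p1, morphism p2, f \o p1 = g \o p2 &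
    forall S (a : S -> X) (b : S -> Y), variety S -> morphism a -> morphism b ->
      f \o a = g \o b ->
      exists! h : S -> P, [/\ morphism h, p1 \o h = a & p2 \o h = b]].

(** Mumford's conditions (i)-(iv): [pi] is constant on orbits; it is
  surjective and its fibres are orbits; it is submersive; and the regular
  functions downstairs are the invariant regular functions upstairs. *)
Definition geometric_quotient X Y (G : Type) (act : X -> G -> X)
    (pi : X -> Y) : Prop :=
  [/\ morphism pi,
      forall x g, pi (act x g) = pi x,
      (forall y, exists x, pi x = y) /\
        (forall x x', pi x = pi x' -> exists g, x' = act x g),
      forall U : set Y, open U <-> open (pi @^-1` U)
    & forall (U : set Y) h, open U -> regular (pi @^-1` U) h ->
        (forall x g, U (pi x) -> h (act x g) = h x) ->
        exists2 f, regular U f & forall x, U (pi x) -> h x = f (pi x)].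

(** Base change is taken in the category of varieties, by its universal
  property; [actP] is the action of [G] on it through the first factor. *)
Definition universal_geometric_quotient X Y (G : Type) (act : X -> G -> X)
    (pi : X -> Y) : Prop :=
  geometric_quotient act pi /\
  forall (Y' P : fspace K) (g : Y' -> Y) (p1 : P -> X) (p2 : P -> Y')
      (actP : P -> G -> P),
    variety Y' -> morphism g -> fibre_product pi g p1 p2 ->
    (forall z c, p1 (actP z c) = act (p1 z) c /\ p2 (actP z c) = p2 z) ->
    geometric_quotient actP p2.

Record quotient_data X (G : Type) (act : X -> G -> X) := QuotientData {
  quot :> fspace K;
  quot_map : X -> quot;
  quot_variety : variety quot;
  quot_universal : universal_geometric_quotient act quot_map }.

End Varieties.

(** The scheme attached to a variety [X] has as underlying space the set of
  irreducible closed subsets of [X]; the point given by [Z] is the generic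
  point of [Z], and the open sets are the [{Z | Z meets U}], for [U] open. *)

Section SchemePoints.
Context (X : topologicalType).

Definition irreducible (Z : set X) : Prop :=
  Z !=set0 /\ forall A B : set X, closed A -> closed B ->
    Z `<=` A `|` B -> Z `<=` A \/ Z `<=` B.

Definition spoint : Type := [set Z : set X | closed Z /\ irreducible Z].
HB.instance Definition _ := Choice.on spoint.

Definition locus (eta : spoint) : set X := val eta.

Lemma locus_closed eta : closed (locus eta).
Proof. by have /set_mem [] := valP eta. Qed.

Lemma locus_irreducible eta : irreducible (locus eta).
Proof. by have /set_mem [] := valP eta. Qed.

Lemma locus_inj : injective locus.
Proof. exact: val_inj. Qed.

Definition spoint_of (Z : set X) (cZ : closed Z) (iZ : irreducible Z) : spoint :=
  set_elt (conj cZ iZ).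

Definition sopen (O : set spoint) : Prop :=
  exists2 U : set X, open U & O = [set eta | locus eta `&` U !=set0].

Lemma sopenT : sopen setT.
Proof.
exists setT; first exact: openT.
rewrite eqEsubset; split => // eta _ /=; rewrite setIT.
by have [] := locus_irreducible eta.
Qed.

Lemma sopenI : setI_closed sopen.
Proof.
move=> _ _ [U oU ->] [V oV ->]; exists (U `&` V); first exact: openI.
rewrite eqEsubset; split => eta /=; last first.
  by move=> [x [Zx [Ux Vx]]]; split; exists x.
move=> [[x [Zx Ux]] [y [Zy Vy]]]; apply: contrapT => /set0P /negP /negPn /eqP H.
have [_ /(_ (~` U) (~` V))] := locus_irreducible eta.
case=> [||z Zz|/(_ _ Zx)//|/(_ _ Zy)//]; first exact: open_closedC.
- exact: open_closedC.
- rewrite -setCI => -[Uz Vz]; suff : (locus eta `&` (U `&` V)) z by rewrite H.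
  by [].
Qed.

Lemma sopen_bigU (I : Type) (F : I -> set spoint) :
  (forall i, sopen (F i)) -> sopen (\bigcup_i F i).
Proof.
move=> H; have /choice [U hU] : forall i, exists U : set X,
    open U /\ F i = [set eta | locus eta `&` U !=set0].
  by move=> i; have [U oU ->] := H i; exists U.
exists (\bigcup_i U i); first by apply: bigcup_open => i _; have [] := hU i.
rewrite eqEsubset; split => eta /=.
  by move=> [i _]; have [_ ->] := hU i => -[x [Zx Ux]]; exists x; split => //; exists i.
move=> [x [Zx [i _ Ux]]]; exists i => //; have [_ ->] := hU i.
by exists x.
Qed.

HB.instance Definition _ :=
  isOpenTopological.Build spoint sopenT sopenI sopen_bigU.

Lemma closure_spoint (A : set spoint) :
  closure A = [set eta | locus eta `<=` closure (\bigcup_(z in A) locus z)].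
Proof.
rewrite eqEsubset; split => eta.
  move=> clA; apply: contrapT => /existsNP [x /not_implyP [Zx nx]].
  have oU : open (~` closure (\bigcup_(z in A) locus z)).
    exact/closed_openC/closed_closure.
  pose O := [set z : spoint | locus z `&` ~` closure (\bigcup_(z in A) locus z) !=set0].
  have oO : open O by exists (~` closure (\bigcup_(z in A) locus z)).
  have /clA [z [Az [y [zy ny]]]] : nbhs eta O.
    by apply: open_nbhs_nbhs; split => //; exists x.
  by apply: ny; apply: subset_closure; exists z.
move=> sub B; rewrite nbhsE => -[O [[U oU OE] Oeta] OB].
move: (Oeta); rewrite OE => -[x [/sub clx Ux]].
have /clx [y [[z Az zy] Uy]] : nbhs x U by exact: open_nbhs_nbhs.
by exists z; split => //; apply: OB; rewrite OE; exists y.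
Qed.

Lemma closure_spoint1 eta :
  closure [set eta] = [set zeta : spoint | locus zeta `<=` locus eta].
Proof.
rewrite closure_spoint bigcup_set1.
by rewrite -(proj1 (closure_id _) (@locus_closed eta)).
Qed.

Lemma closure_spoint1_inj (eta zeta : spoint) :
  closure [set eta] = closure [set zeta] -> eta = zeta.
Proof.
rewrite !closure_spoint1 => E; apply: locus_inj; rewrite eqEsubset; split.
  have : [set z : spoint | locus z `<=` locus eta] eta by [].
  by rewrite E.
have : [set z : spoint | locus z `<=` locus zeta] zeta by [].
by rewrite -E.
Qed.

End SchemePoints.

Lemma closure_min (X : topologicalType) (A C : set X) :
  A `<=` C -> closed C -> closure A `<=` C.
Proof. by move=> AC cC; rewrite closureE; exact: smallest_sub. Qed.

Section SchemeMap.
Context (X Y : topologicalType) (f : X -> Y).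

Lemma irreducible_closure (Z : set Y) : irreducible Z -> irreducible (closure Z).
Proof.
move=> [[x Zx] H]; split; first by exists x; exact: subset_closure.
move=> A B cA cB sub.
have [ZA|ZB] := H A B cA cB (subset_trans (@subset_closure _ _) sub).
- by left; rewrite closureE; exact: smallest_sub.
- by right; rewrite closureE; exact: smallest_sub.
Qed.

Lemma irreducible_image (Z : set X) :
  continuous f -> irreducible Z -> irreducible (f @` Z).
Proof.
move=> cf [[x Zx] H]; split; first by exists (f x), x.
move=> A B cA cB sub.
have := H (f @^-1` A) (f @^-1` B) 
  (proj1 (continuous_closedP f) cf _ cA) (proj1 (continuous_closedP f) cf _ cB).
case=> [z Zz|h|h]; first by apply: sub; exists z.
- by left => _ [z /h Az <-].
- by right => _ [z /h Bz <-].
Qed.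

Definition spoint_map (cf : continuous f) (eta : spoint X) : spoint Y :=
  @spoint_of Y (closure (f @` locus eta)) (@closed_closure _ _)
    (irreducible_closure (irreducible_image cf (locus_irreducible eta))).

End SchemeMap.

Section Flags.
Context (K : numClosedFieldType) (n : nat).

(** Computed in the basis [vbasis W]; the columns in [I] are taken in
  increasing order.  Meaningful if [\dim W = #|I| = r]. *)
Definition pluecker (r : nat) (W : {vspace 'rV[K]_n}) (I : {set 'I_n}) : K :=
  \det (\matrix_(i < r, j < r)
          nth 0 [seq (vbasis W)`_i 0 c | c <- enum I] j).

Definition torus : Type :=
  {g : 'M[K]_n | is_diag_mx g && (g \in unitmx)}.

Definition subspace_act (W : {vspace 'rV[K]_n}) (g : 'M[K]_n) :=
  (linfun (mulmxr g : 'rV[K]_n -> 'rV[K]_n) @: W)%VS.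

Lemma torus_mulP (g h : torus) :
  is_diag_mx (val g *m val h) && (val g *m val h \in unitmx).
Proof.
case: g h => [g /= /andP[dg ug]] [h /= /andP[dh uh]].
rewrite unitmx_mul ug uh !andbT.
apply/is_diag_mxP => i j ij; rewrite mxE big1 // => l _.
have [il|il] := eqVneq (i : nat) l; last by rewrite (is_diag_mxP dg) ?mul0r.
by rewrite (is_diag_mxP dh) ?mulr0 // -il.
Qed.

Definition torus_mul (g h : torus) : torus :=
  exist (fun a => is_diag_mx a && (a \in unitmx)) _ (torus_mulP g h).

Lemma torus1P : is_diag_mx (1%:M : 'M[K]_n) && ((1%:M : 'M[K]_n) \in unitmx).
Proof. by rewrite unitmx1 scalar_mx_is_diag. Qed.

Definition torus1 : torus :=
  exist (fun a => is_diag_mx a && (a \in unitmx)) _ torus1P.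

Lemma torus_neq0 (g : torus) j : val g j j != 0.
Proof.
case: g => g /= /andP[/is_diag_mxP dg]; rewrite unitmxE unitfE.
apply: contraNneq => gj; rewrite (expand_det_row _ j) big1 // => l _.
have [<-|jl] := eqVneq j l; first by rewrite gj mul0r.
by rewrite dg ?mul0r.
Qed.

Lemma subspace_actM W (g h : 'M[K]_n) :
  subspace_act (subspace_act W g) h = subspace_act W (g *m h).
Proof.
rewrite /subspace_act -limg_comp; congr (_ @: W)%VS.
by apply/lfunP => v; rewrite comp_lfunE !lfunE /= mulmxA.
Qed.

Lemma subspace_act1 W : subspace_act W 1%:M = W.
Proof.
rewrite /subspace_act -[RHS]lim1g; congr (_ @: W)%VS.
by apply/lfunP => v; rewrite !lfunE /= mulmx1.
Qed.

Lemma dim_subspace_act W (g : 'M[K]_n) :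
  g \in unitmx -> \dim (subspace_act W g) = \dim W.
Proof.
move=> ug; apply: limg_dim_eq; apply/eqP; rewrite -subv0; apply/subvP => v.
rewrite memv_cap memv_ker lfunE /= memv0 => /andP[_ /eqP vg].
by rewrite -(mulmxK ug v) vg mul0mx.
Qed.

Definition frame (r : nat) (W : {vspace 'rV[K]_n}) : 'M[K]_(r, n) :=
  \matrix_(i < r) (vbasis W)`_i.

Lemma nth_enum_col (r : nat) (I : {set 'I_n}) : #|I| = r ->
  exists s : 'I_r -> 'I_n,
    (forall (f : 'I_n -> K) (j : 'I_r), nth 0 [seq f c | c <- enum I] j = f (s j)) /\
    (forall f : 'I_n -> K, \prod_(j < r) f (s j) = \prod_(j in I) f j).
Proof.
move=> <-; exists (@enum_val _ (mem I)); split.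
  move=> f j; rewrite (nth_map (enum_val j)) -?cardE ?ltn_ord //.
  by rewrite -enum_val_nth.
by move=> f; rewrite [RHS]big_enum_val.
Qed.

Lemma frame_act (r : nat) W (g : 'M[K]_n) : \dim W = r -> g \in unitmx ->
  exists2 D : 'M[K]_r, D \in unitmx & frame r (subspace_act W g) = D *m (frame r W *m g).
Proof.
move=> dW ug.
have span U v : \dim U = r -> v \in U -> (v <= frame r U)%MS.
  move=> dU /coord_vbasis ->; rewrite summx_sub // => i _.
  rewrite scalemx_sub //.
  have -> : (vbasis U)`_i = row (cast_ord dU i) (frame r U) by rewrite rowK.
  exact: row_sub.
have mem (U : {vspace 'rV[K]_n}) i : \dim U = r -> (i < r)%N -> (vbasis U)`_i \in U.
  by move=> dU ir; apply: vbasis_mem; rewrite mem_nth // size_tuple dU.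
have dWg : \dim (subspace_act W g) = r by rewrite dim_subspace_act.
have /submxP [D eD] : (frame r (subspace_act W g) <= frame r W *m g)%MS.
  apply/row_subP => i; rewrite rowK.
  have /memv_imgP [w wW ->] := mem _ i dWg (ltn_ord i).
  by rewrite lfunE /=; apply: submxMr; exact: span.
have /submxP [D' eD'] : (frame r W *m g <= frame r (subspace_act W g))%MS.
  apply/row_subP => i; rewrite row_mul rowK; apply: span => //.
  have -> : (vbasis W)`_i *m g = linfun (mulmxr g : 'rV[K]_n -> 'rV[K]_n) (vbasis W)`_i.
    by rewrite lfunE.
  by apply: memv_img; exact: mem.
exists D => //; have free : row_free (frame r (subspace_act W g)).
  have : free (vbasis (subspace_act W g)) by exact: basis_free (vbasisP _).
  move: dWg; set U := subspace_act W g => dU fU.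
  rewrite -kermx_eq0; apply/rowV0P => u /sub_kermxP u0.
  apply/rowP => i; rewrite mxE.
  have /freeP /(_ (fun j => u 0 (cast_ord dU j))) := fU.
  move=> /(_ _ (cast_ord (esym dU) i)); rewrite cast_ordKV; apply.
  rewrite -[RHS]u0 mulmx_sum_row [RHS](reindex (cast_ord dU)) /=; last first.
    by exists (cast_ord (esym dU)) => j _; rewrite ?cast_ordK ?cast_ordKV.
  by apply: eq_bigr => j _; rewrite rowK.
have : D *m D' = 1%:M.
  apply: (row_free_inj free); rewrite mul1mx -mulmxA -eD'.
  by rewrite -eD.
by case/mulmx1_unit.
Qed.

Lemma pluecker_act (r : nat) W (g : torus) : \dim W = r ->
  exists2 c : K, c != 0 & forall I : {set 'I_n}, #|I| = r ->
    pluecker r (subspace_act W (val g)) I =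
      c * (\prod_(j in I) val g j j) * pluecker r W I.
Proof.
move=> dW; have /andP[/is_diag_mxP dg ug] := valP g.
have [D uD eD] := frame_act dW ug.
exists (\det D); first by rewrite -unitfE -unitmxE.
move=> I cI; have [s [hs ps]] := nth_enum_col cI.
have pE U : pluecker r U I = \det (colsub s (frame r U)).
  by congr determinant; apply/matrixP => i j; rewrite !mxE hs.
have -> : \prod_(j in I) val g j j = \det (diag_mx (\row_j val g (s j) (s j))).
  rewrite det_diag -(ps (fun j => val g j j)).
  by apply: eq_bigr => j _; rewrite mxE.
rewrite !pE eD mulrAC -mulrA -!det_mulmx; congr determinant.
rewrite mulmxA -mulmxA; apply/matrixP => i j.
rewrite [LHS]mxE !mxE; apply: eq_bigr => l _; congr (_ * _).
rewrite !mxE (bigD1 (s j)) //= big1 ?addr0; last first.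
  by move=> t tj; rewrite dg ?mulr0.
rewrite (bigD1 j) //= big1 ?addr0; last first.
  by move=> t tj; rewrite !mxE (negPf tj) mulr0n mulr0.
by rewrite !mxE eqxx mulr1n.
Qed.

End Flags.

Record matroid (n r : nat) := Matroid {
  bases : {set {set 'I_n}};
  bases_nonempty : bases != finset.set0;
  bases_card : forall I, I \in bases -> #|I| = r;
  bases_exchange : forall I J, I \in bases -> J \in bases ->
    forall i, i \in I :\: J ->
      exists2 j, j \in J :\: I & j |: (I :\ i) \in bases }.

Definition plurimatroid (n k : nat) (d : 'I_k -> nat) : Type :=
  forall i : 'I_k, matroid n (d i).

Section FlagVariety.
Context (K : numClosedFieldType) (n k : nat) (d : 'I_k -> nat).

Definition is_flag (W : {ffun 'I_k -> {vspace 'rV[K]_n}}) : bool :=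
  [forall i, \dim (W i) == d i] &&
  [forall i : 'I_k, forall j : 'I_k, (i <= j)%N ==> (W i <= W j)%VS].

Definition flag : Type := {W : {ffun 'I_k -> {vspace 'rV[K]_n}} | is_flag W}.
HB.instance Definition _ := Choice.on flag.

Definition step (W : flag) (i : 'I_k) : {vspace 'rV[K]_n} := val W i.

Lemma step_dim (W : flag) i : \dim (step W i) = d i.
Proof. by have /andP[/forallP /(_ i) /eqP] := valP W. Qed.

(** The homogeneous coordinates of the product of the Plücker embeddings: the
  variables are the pairs [(i, I)] with [I] a [d i]-subset, in degree [i]. *)
Definition pluecker_var : Type := {i : 'I_k & {I : {set 'I_n} | #|I| == d i}}.
HB.instance Definition _ := Finite.on pluecker_var.

Definition flag_coord (W : flag) (v : 'I_#|{: pluecker_var}|) : K :=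
  let s := enum_val v in
  pluecker (d (tag s)) (step W (tag s)) (val (tagged s)).

Definition flag_degree (v : 'I_#|{: pluecker_var}|) (i : 'I_k) : nat :=
  tag (enum_val v) == i.

Definition flag_variety : fspace K :=
  @FSpace K (zariski flag_coord flag_degree) (@zregular _ _ _ _ _ _).

Lemma flag_actP (W : flag) (g : torus K n) :
  is_flag [ffun i => subspace_act (step W i) (val g)].
Proof.
have /andP[_ ug] := valP g; have /andP[dW sW] := valP W.
apply/andP; split.
  by apply/forallP => i; rewrite ffunE dim_subspace_act // step_dim.
apply/forallP => i; apply/forallP => j; apply/implyP => ij.
rewrite !ffunE limgS //.
by move/forallP/(_ i)/forallP/(_ j)/implyP: sW; apply.
Qed.

Definition flag_act (W : flag_variety) (g : torus K n) : flag_variety :=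
  exist (fun W => is_flag W) _ (flag_actP W g).

Lemma flag_actM W g h : flag_act (flag_act W g) h = flag_act W (torus_mul g h).
Proof.
apply: val_inj; apply/ffunP => i; rewrite /= !ffunE.
by rewrite /step /= ffunE subspace_actM.
Qed.

Lemma flag_act1 W : flag_act W (torus1 K n) = W.
Proof.
by apply: val_inj; apply/ffunP => i; rewrite /= ffunE subspace_act1.
Qed.

Definition chi (a : 'I_n -> K) (v : 'I_#|{: pluecker_var}|) : K :=
  \prod_(j in val (tagged (enum_val v))) a j.

Lemma meval_scale e (p : mpoly _ K) (c : 'I_k -> K) x :
  multihomogeneous flag_degree e p ->
  meval (fun v => (\prod_i c i ^+ flag_degree v i) * x v) p =
  (\prod_i c i ^+ e i) * meval x p.
Proof.
move=> hp; rewrite !mevalE mulr_sumr; apply: eq_big_seq => m /hp hm.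
rewrite mulrCA; congr (_ * _).
under eq_bigr do rewrite exprMn.
rewrite big_split /=; congr (_ * _).
under eq_bigr do rewrite -prodrXl.
rewrite exchange_big /=; apply: eq_bigr => i _.
rewrite -(hm i) expr_sum; apply: eq_bigr => v _.
by rewrite -exprM mulnC.
Qed.

Lemma form_act e (p : mpoly _ K) x g : multihomogeneous flag_degree e p ->
  exists2 c : K, c != 0 & meval (flag_coord (flag_act x g)) p =
    c * meval (fun v => chi (fun j => val g j j) v * flag_coord x v) p.
Proof.
move=> hp.
have /choice [c hc] : forall i, exists c : K, c != 0 /\
    forall I : {set 'I_n}, #|I| = d i ->
      pluecker (d i) (step (flag_act x g) i) I =
        c * (\prod_(j in I) val g j j) * pluecker (d i) (step x i) I.
  move=> i; have [c c0 hc] := pluecker_act g (step_dim x i).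
  by exists c; split => // I cI; rewrite {1}/step ffunE hc.
exists (\prod_i c i ^+ e i).
  by apply/prodf_neq0 => i _; rewrite expf_neq0 //; have [] := hc i.
rewrite -meval_scale //; apply: meval_eq => v.
rewrite /flag_coord /chi; set s := enum_val v.
have [_ ->] := hc (tag s); last by apply/eqP; exact: (valP (tagged s)).
rewrite mulrA; congr (_ * _ * _).
rewrite (bigD1 (tag s)) //= big1 ?mulr1 ?/flag_degree -/s ?eqxx ?expr1 //.
by move=> i /negPf; rewrite /flag_degree -/s eq_sym => ->; rewrite expr0.
Qed.

Lemma form_scale e (p : mpoly _ K) (a : 'I_n -> K) :
  multihomogeneous flag_degree e p ->
  form flag_coord flag_degree e
    (fun x : flag => meval (fun v => chi a v * flag_coord x v) p).
Proof.
move=> hp; pose q : mpoly _ K :=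
  \sum_(m <- msupp p) (mcoeff m p * \prod_v chi a v ^+ m v) *: mpolyX K m.
exists q; last first.
  move=> x; rewrite mevalE /q raddf_sum /=; apply: eq_bigr => m _.
  rewrite mevalZ mevalX -mulrA -big_split /=; congr (_ * _).
  by apply: eq_bigr => v _; rewrite exprMn.
move=> m mq; apply: hp; apply: contraLR mq => mp.
rewrite mcoeff_msupp negbK /q raddf_sum /= big_seq big1 // => m' m'p.
rewrite mcoeffZ mcoeffX; case: eqP => [E|]; last by rewrite mulr0.
by rewrite -E m'p in mp.
Qed.

Lemma flag_act_continuous g : continuous (flag_act ^~ g).
Proof.
apply/continuousP => U [S [hS ->]].
exists [set f | exists e p, [/\ multihomogeneous flag_degree e p,
    S (fun x => meval (flag_coord x) p) &
    f = fun x => meval (fun v => chi (fun j => val g j j) v * flag_coord x v) p]].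
split; first by move=> _ [e [p [hp _ ->]]]; exists e; exact: form_scale.
rewrite -preimage_setC; congr (~` _); rewrite eqEsubset; split => x /=.
  move=> H _ [e [p [hp Sp ->]]]; have := H _ Sp.
  have [c c0 ->] := form_act x g hp.
  by move=> /eqP; rewrite mulf_eq0 (negPf c0) => /eqP.
move=> H f Sf; have [e [p hp fE]] := hS _ Sf.
have {}fE : f = fun x => meval (flag_coord x) p by apply: funext.
rewrite fE; have [c c0 ->] := form_act x g hp.
by rewrite (H _ (ex_intro _ e (ex_intro _ p (And3 hp _ erefl)))) ?mulr0 -?fE.
Qed.

Lemma poly_nonroot (q : {poly K}) : q != 0 -> exists a, q.[a] != 0.
Proof.
move=> q0; apply: contrapT => /forallNP H.
have := @max_poly_roots K q [seq i%:R | i <- iota 0 (size q)] q0.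
rewrite size_map size_iota ltnn => F; apply/notF/F.
  by apply/allP => _ /mapP [i _ ->]; apply/negPn/negP => /H.
rewrite map_inj_uniq ?iota_uniq // => i j /eqP.
by rewrite eqr_nat => /eqP.
Qed.

Lemma flag_orbit_avoid e1 e2 (p1 p2 : mpoly _ K) x g h :
  multihomogeneous flag_degree e1 p1 -> multihomogeneous flag_degree e2 p2 ->
  meval (flag_coord (flag_act x g)) p1 != 0 ->
  meval (flag_coord (flag_act x h)) p2 != 0 ->
  exists l, meval (flag_coord (flag_act x l)) p1 != 0 /\
            meval (flag_coord (flag_act x l)) p2 != 0.
Proof.
move=> h1 h2 n1 n2.
pose line j : {poly K} := (val g j j)%:P + (val h j j - val g j j) *: 'X.
have lineE j a : (line j).[a] = val g j j + (val h j j - val g j j) * a.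
  by rewrite /line !hornerE.
pose pull (p : mpoly #|{: pluecker_var}| K) : {poly K} := \sum_(m <- msupp p) (mcoeff m p)%:P *
  \prod_(v < #|{: pluecker_var}|) ((\prod_(j in val (tagged (enum_val v))) line j) * (flag_coord x v)%:P) ^+ m v.
have pullE p a :
    (pull p).[a] = meval (fun v => chi (fun j => (line j).[a]) v * flag_coord x v) p.
  rewrite mevalE /pull horner_sum; apply: eq_bigr => m _.
  rewrite hornerM hornerC horner_prod; congr (_ * _); apply: eq_bigr => v _.
  by rewrite horner_exp hornerM hornerC horner_prod.
pose r := \prod_j line j.
have g0 : (fun j => (line j).[0]) = (fun j => val g j j).
  by apply: funext => j; rewrite lineE mulr0 addr0.
have gh : (fun j => (line j).[1]) = (fun j => val h j j).
  by apply: funext => j; rewrite lineE mulr1 addrC subrK.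
have P1 : pull p1 != 0.
  apply: contraNneq n1 => z; have [c c0 ->] := form_act x g h1.
  by rewrite -g0 -pullE z horner0 mulr0.
have P2 : pull p2 != 0.
  apply: contraNneq n2 => z; have [c c0 ->] := form_act x h h2.
  by rewrite -gh -pullE z horner0 mulr0.
have R0 : r != 0.
  apply: contraTneq isT => z; have : r.[0] != 0; last by rewrite z horner0 eqxx.
  rewrite horner_prod; apply/prodf_neq0 => j _.
  by rewrite lineE mulr0 addr0 torus_neq0.
have [a] := poly_nonroot (mulf_neq0 (mulf_neq0 P1 P2) R0).
rewrite !hornerM !mulf_eq0 !negb_or => /andP[/andP[Q1 Q2]].
rewrite horner_prod => /prodf_neq0 Rj.
pose lm : 'M[K]_n := diag_mx (\row_j (line j).[a]).
have lP : is_diag_mx lm && (lm \in unitmx).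
  rewrite diag_mx_is_diag unitmxE unitfE det_diag.
  by apply/prodf_neq0 => j _; rewrite mxE Rj.
pose l : torus K n := exist (fun a => is_diag_mx a && (a \in unitmx)) lm lP.
have lE : (fun j => val l j j) = (fun j => (line j).[a]).
  by apply: funext => j; rewrite /= !mxE eqxx mulr1n.
exists l; split.
  by have [c c0 ->] := form_act x l h1; rewrite mulf_neq0 // lE -pullE.
by have [c c0 ->] := form_act x l h2; rewrite mulf_neq0 // lE -pullE.
Qed.

Lemma zclosedP (A : set flag_variety) : closed A ->
  exists S : set (flag -> K),
    (forall f, S f -> exists e, form flag_coord flag_degree e f) /\
    A = [set x | forall f, S f -> f x = 0].
Proof.
rewrite -openC => -[S [hS E]]; exists S; split => //.
by rewrite -[LHS]setCK E setCK.
Qed.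

Lemma flag_orbit_irreducible x (A B : set flag_variety) : closed A -> closed B ->
  (forall g, (A `|` B) (flag_act x g)) ->
  (forall g, A (flag_act x g)) \/ (forall g, B (flag_act x g)).
Proof.
move=> /zclosedP [S [hS ->]] /zclosedP [T [hT ->]] H.
apply: contrapT => /not_orP [/existsNP [g /existsNP [f1 /not_implyP [S1 n1]]]].
move=> /existsNP [h /existsNP [f2 /not_implyP [S2 n2]]].
have [e1 [p1 h1 E1]] := hS _ S1; have [e2 [p2 h2 E2]] := hT _ S2.
have := flag_orbit_avoid (x := x) (g := g) (h := h) h1 h2.
rewrite -!E1 -!E2 => /(_ _ _) [||l]; try exact/eqP.
rewrite -E1 -E2 => -[/eqP m1 /eqP m2].
by have [/(_ _ S1)|/(_ _ S2)] := H l.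
Qed.

Definition spoint_act (g : torus K n) : spoint flag_variety -> spoint flag_variety :=
  spoint_map (@flag_act_continuous g).

Definition invariant_points : set (spoint flag_variety) :=
  [set eta | forall g zeta, closure [set eta] zeta ->
    closure [set eta] (spoint_act g zeta)].

Section ThinCell.
Context (M : plurimatroid n d).

Definition thin_cell : set flag_variety :=
  [set W : flag | forall i (I : {set 'I_n}), #|I| = d i ->
    (pluecker (d i) (step W i) I != 0 <-> I \in bases (M i))].

Definition thin_cell_variety : fspace K := sub_fspace thin_cell.

Lemma thin_cell_actP W g : thin_cell W -> thin_cell (flag_act W g).
Proof.
move=> hW i I cI; rewrite -(hW i I cI) {1}/step ffunE.
have [c c0 ->] := pluecker_act g (step_dim W i) => //.
rewrite !mulf_eq0 (negPf c0) /=.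
suff /negPf -> : \prod_(j in I) val g j j != 0 by [].
by apply/prodf_neq0 => j _; exact: torus_neq0.
Qed.

Definition thin_cell_act (x : thin_cell_variety) (g : torus K n) :
    thin_cell_variety :=
  set_elt (thin_cell_actP g (set_mem (valP x))).

Definition torus_stab : set (torus K n) :=
  [set s | forall x, thin_cell_act x s = x].

Definition coset (g : torus K n) : set (torus K n) :=
  [set h | exists2 s, torus_stab s & h = torus_mul s g].

Definition quotient_torus : Type :=
  [set c : set (torus K n) | exists g, c = coset g].

Definition coset_repr (c : quotient_torus) : torus K n :=
  projT1 (cid (set_mem (valP c))).

Definition quotient_torus_act (x : thin_cell_variety) (c : quotient_torus) :
    thin_cell_variety := thin_cell_act x (coset_repr c).

Definition coset_class (g : torus K n) : quotient_torus :=
  set_elt (ex_intro _ g erefl).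

Lemma val_thin_cell_act x g : val (thin_cell_act x g) = flag_act (val x) g.
Proof. by []. Qed.

Lemma quotient_torus_actE x g :
  quotient_torus_act x (coset_class g) = thin_cell_act x g.
Proof.
rewrite /quotient_torus_act /coset_repr; case: cid => h /= E.
have : coset g g.
  exists (torus1 K n); last by apply: val_inj; rewrite /= mul1mx.
  by move=> y; apply: val_inj; rewrite val_thin_cell_act flag_act1.
rewrite E => -[s sS ->]; apply: val_inj.
by rewrite !val_thin_cell_act -flag_actM -[flag_act _ s]val_thin_cell_act sS.
Qed.

Lemma thin_cell_incl_continuous :
  continuous (val : thin_cell_variety -> flag_variety).
Proof. exact: initial_continuous. Qed.

Lemma thin_cell_closedP (A : set thin_cell_variety) : closed A ->
  exists2 A' : set flag_variety, closed A' & A = val @^-1` A'.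
Proof.
rewrite -openC => -[U oU E]; exists (~` U); first exact: open_closedC.
by rewrite -preimage_setC -[LHS]setCK -E.
Qed.

Section Quotient.
Context (Q : quotient_data quotient_torus_act).

Lemma quot_map_continuous : continuous (@quot_map _ _ _ _ Q).
Proof. by have [[[]]] := quot_universal Q. Qed.

Lemma quot_map_act x g : quot_map Q (thin_cell_act x g) = quot_map Q x.
Proof.
by rewrite -quotient_torus_actE; have [[_ ->]] := quot_universal Q.
Qed.

Lemma preimage_irreducible (Y : set Q) : closed Y -> irreducible Y ->
  irreducible (quot_map Q @^-1` Y).
Proof.
move=> cY [[y Yy] irrY].
have [[mor inv [surj fib] sub _] _] := quot_universal Q.
split; first by have [x xy] := surj y; exists x; rewrite /preimage /= xy.
pose core (A : set thin_cell_variety) := [set x | forall g, A (thin_cell_act x g)].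
have core_sat A x x' : core A x -> quot_map Q x = quot_map Q x' -> core A x'.
  move=> cAx /fib [c ->] g; rewrite /quotient_torus_act.
  have -> : thin_cell_act (thin_cell_act x (coset_repr c)) g =
            thin_cell_act x (torus_mul (coset_repr c) g).
    by apply: val_inj; rewrite !val_thin_cell_act flag_actM.
  exact: cAx.
have core_closed A : closed A -> closed (core A).
  move=> /thin_cell_closedP [A' cA' ->].
  have -> : core (val @^-1` A') =
      \bigcap_(g in setT) (val @^-1` (flag_act ^~ g @^-1` A')).
    by rewrite eqEsubset; split => x H g; [move=> _; exact: H|exact: H].
  apply: closed_bigI => g _.
  apply: (proj1 (continuous_closedP _) thin_cell_incl_continuous).
  by apply: (proj1 (continuous_closedP _) (@flag_act_continuous g)).
have im_pre A : quot_map Q @^-1` (quot_map Q @` core A) = core A.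
  rewrite eqEsubset; split => x; last by exists x.
  by move=> [x' cx' E]; exact: core_sat cx' E.
have im_closed A : closed A -> closed (quot_map Q @` core A).
  by move=> cA; rewrite -openC; apply/sub; rewrite -preimage_setC im_pre openC; exact: core_closed.
move=> A B cA cB sAB.
have core_sub C : core C `<=` C.
  move=> x /(_ (torus1 K n)).
  suff -> : thin_cell_act x (torus1 K n) = x by [].
  by apply: val_inj; rewrite val_thin_cell_act flag_act1.
have := irrY (quot_map Q @` core A) (quot_map Q @` core B) (im_closed _ cA) (im_closed _ cB).
case.
- move=> z Yz; have [x xz] := surj z.
  have [A' cA' EA] := thin_cell_closedP cA.
  have [B' cB' EB] := thin_cell_closedP cB.
  have [|H|H] := @flag_orbit_irreducible (val x) A' B' cA' cB'.
  + move=> g; rewrite -val_thin_cell_act.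
    have : (A `|` B) (thin_cell_act x g).
      by apply: sAB; rewrite /preimage /= quot_map_act xz.
    by rewrite EA EB.
  + by left; exists x => // g; rewrite EA; exact: H.
  + by right; exists x => // g; rewrite EB; exact: H.
- move=> H; left => x Yx; apply: core_sub; rewrite -im_pre; exact: H.
- move=> H; right => x Yx; apply: core_sub; rewrite -im_pre; exact: H.
Qed.

Lemma V_existence (y : spoint Q) : exists eta : invariant_points,
  closure [set val eta] =
  closure (spoint_map thin_cell_incl_continuous @`
           (spoint_map quot_map_continuous @^-1` closure [set y])).
Proof.
pose P := quot_map Q @^-1` locus y.
have cP : closed P.
  apply: (proj1 (continuous_closedP _) quot_map_continuous).
  exact: locus_closed.
have iP : irreducible P.
  by apply: preimage_irreducible; [exact: locus_closed|exact: locus_irreducible].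
pose eta := spoint_map thin_cell_incl_continuous (spoint_of cP iP).
have eta_inv : invariant_points eta.
  move=> g zeta; rewrite !closure_spoint1 => /= sub.
  apply: (@closure_min _ (flag_act ^~ g @` locus zeta)); last exact: closed_closure.
  move=> _ [x /sub clx <-].
  suff : closure (val @` P) `<=` flag_act ^~ g @^-1` closure (val @` P) by apply.
  apply: closure_min; last first.
    apply: (proj1 (continuous_closedP _) (@flag_act_continuous g)).
    exact: closed_closure.
  move=> _ [z Pz <-]; apply: subset_closure.
  by exists (thin_cell_act z g); rewrite // /P /preimage /= quot_map_act.
exists (set_elt eta_inv); rewrite closure_spoint1 closure_spoint.
suff -> : closure (\bigcup_(z in spoint_map thin_cell_incl_continuous @`
    (spoint_map quot_map_continuous @^-1` closure [set y])) locus z) = locus eta by [].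
rewrite eqEsubset; split.
  apply: closure_min; last exact: locus_closed.
  move=> x [_ [zeta + <-]]; rewrite /preimage /= closure_spoint1 /= => sub.
  move: x; apply: (@closure_min _ (val @` locus zeta)); last exact: closed_closure.
  move=> _ [z zz <-]; apply: subset_closure; exists z => //.
  by apply: sub; apply: subset_closure; exists z.
apply: (@closure_min _ (val @` P)); last exact: closed_closure.
move=> x Px; apply: subset_closure; exists eta; last exact: subset_closure.
exists (spoint_of cP iP) => //; rewrite /preimage /= closure_spoint1 /=.
apply: (@closure_min _ (quot_map Q @` P)); last exact: locus_closed.
by move=> _ [z Pz <-].
Qed.

(** The point [eta] with closure the closure of [pi^-1(closure {y})]; it is
  unique by [closure_spoint1_inj]. *)
Definition V_map (y : spoint Q) : invariant_points :=
  projT1 (cid (V_existence y)).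

End Quotient.
End ThinCell.

Definition V_union (F : forall M, quotient_data (@quotient_torus_act M))
    (y : {M : plurimatroid n d & spoint (F M)}) : invariant_points :=
  V_map (projT2 y).

End FlagVariety.

Arguments V_union {K n k d} F y.

(* Main.v *)
Require Import Defs.
From mathcomp Require Import all_boot all_order all_algebra.
From mathcomp Require Import all_classical all_reals topology.
From mathcomp Require Import complex.
From mathcomp Require Import -(notations) mpoly.

Set Implicit Arguments.
Unset Strict Implicit.
Unset Printing Implicit Defensive.

Import GRing.Theory.
Local Open Scope classical_set_scope.
Local Open Scope ring_scope.

(** Let [Z] be the closure of an invariant point.  As [Z] is irreducible, some
  flag [W] in [Z] has all the Pluecker coordinates nonzero that do not vanish
  identically on [Z].  If [M] is the plurimatroid of [W], the flags of [Z] in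
  the thin cell of [M] are exactly those where these coordinates are all
  nonzero, so they form a dense open subset of [Z].  This subset is closed in
  the cell, irreducible and a union of orbits, hence it is the preimage of an
  irreducible closed subset of the quotient, whose generic point maps to the
  generic point of [Z]. *)

(** * Irreducible sets, their open subsets and their traces on subspaces *)

Section IrreducibleSets.
Context {X : topologicalType}.
Implicit Types Z U : set X.

(** Otherwise the complements of [U] and [V] would be two closed sets covering [Z], and one of them
    would contain it. *)
Lemma irreducible_meetI Z U V : irreducible Z -> open U -> open V ->
  Z `&` U !=set0 -> Z `&` V !=set0 -> Z `&` (U `&` V) !=set0.
Proof.
move=> [_ irrZ] oU oV [x [Zx Ux]] [y [Zy Vy]].
apply: contrapT => noUV.
have [||z Zz|/(_ _ Zx)//|/(_ _ Zy)//] := irrZ (~` U) (~` V).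
- exact: open_closedC.
- exact: open_closedC.
- by rewrite -setCI => -[Uz Vz]; apply: noUV; exists z.
Qed.

Lemma irreducible_meet_bigcap Z (I : choiceType) (s : seq I) (U : I -> set X) :
  irreducible Z -> (forall i, i \in s -> open (U i) /\ Z `&` U i !=set0) ->
  open (\bigcap_(i in [set` s]) U i) /\ Z `&` \bigcap_(i in [set` s]) U i !=set0.
Proof.
move=> irrZ hU; rewrite bigcap_seq big_seq.
elim/big_ind: _ => [|V V' [oV ZV] [oV' ZV']|//].
  by split; [exact: openT|rewrite setIT; case: irrZ].
by split; [exact: openI|exact: irreducible_meetI].
Qed.

Lemma irreducible_dense_open Z U : irreducible Z -> open U ->
  Z `&` U !=set0 -> Z `<=` closure (Z `&` U).
Proof.
move=> irrZ oU ZU z Zz V; rewrite nbhsE => -[W [oW Wz] WV].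
have [|x [Zx [Ux Wx]]] := irreducible_meetI irrZ oU oW ZU; first by exists z.
by exists x; split => //; exact: WV.
Qed.

(** Closed subsets of [A] are traces of closed subsets of [X], so a closed cover of the trace of [Z]
    comes from a closed set containing [Z] on [A], hence containing all of [Z] by density. *)
Lemma subspace_irreducible (A Z : set X) :
  irreducible Z -> Z `<=` closure (Z `&` A) ->
  irreducible (val @^-1` Z : set (set_type A)).
Proof.
move=> [[z0 Zz0] irrZ] dense; split.
  have [z [[Zz Az] _]] := dense _ Zz0 setT (@filterT _ _ _).
  by exists (set_elt Az).
have closedP (C : set (set_type A)) : closed C ->
    exists2 C' : set X, closed C' & C = val @^-1` C'.
  rewrite -openC => -[U oU E]; exists (~` U); first exact: open_closedC.
  by rewrite -preimage_setC -[LHS]setCK -E.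
move=> _ _ /closedP[B cB ->] /closedP[C cC ->] sub.
have [|ZB|ZC] := irrZ _ _ cB cC.
- apply: (subset_trans dense); apply: closure_min; last exact: closedU.
  by move=> x [Zx Ax]; exact: (sub (set_elt Ax)).
- by left=> x Zx; exact: ZB.
- by right=> x Zx; exact: ZC.
Qed.

End IrreducibleSets.

(** * The matroid of a linear subspace *)

Section PlueckerMatroid.
Context (K : numClosedFieldType) (n : nat).
Implicit Types W : {vspace 'rV[K]_n}.

Lemma frame_row_free r W : \dim W = r -> row_free (frame r W).
Proof.
move=> dW; rewrite -kermx_eq0; apply/rowV0P => u /sub_kermxP u0.
apply/rowP => i; rewrite mxE.
have /freeP /(_ (fun j => u 0 (cast_ord dW j))) := basis_free (vbasisP W).
move=> /(_ _ (cast_ord (esym dW) i)); rewrite cast_ordKV; apply.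
rewrite -[RHS]u0 mulmx_sum_row [RHS](reindex (cast_ord dW)) /=; last first.
  by exists (cast_ord (esym dW)) => j _; rewrite ?cast_ordK ?cast_ordKV.
by apply: eq_bigr => j _; rewrite rowK.
Qed.

Lemma plueckerE W (I : {set 'I_n}) :
  pluecker #|I| W I = \det (colsub (@enum_val _ (mem I)) (frame #|I| W)).
Proof.
congr determinant; apply/matrixP => i j; rewrite !mxE.
by rewrite (nth_map (enum_val j)) -?cardE ?ltn_ord // -enum_val_nth.
Qed.

Lemma mul_colsub m r p (u : 'M[K]_(m, r)) (A : 'M[K]_(r, n)) (f : 'I_p -> 'I_n) i j :
  (u *m colsub f A) i j = (u *m A) i (f j).
Proof. by rewrite !mxE; apply: eq_bigr => l _; rewrite !mxE. Qed.

(** The columns of the frame indexed by [I] form a square matrix, which is invertible exactly when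
    its left kernel is trivial. *)
Lemma pluecker_neq0P r W (I : {set 'I_n}) : #|I| = r ->
  reflect (forall u : 'rV[K]_r,
      (forall c, c \in I -> (u *m frame r W) 0 c = 0) -> u = 0)
    (pluecker r W I != 0).
Proof.
move=> <-; rewrite plueckerE -unitfE -unitmxE -row_free_unit -kermx_eq0.
apply: (iffP rowV0P) => H u.
  move=> u0; apply: H; apply/sub_kermxP/rowP => j.
  by rewrite mul_colsub u0 ?mxE // enum_valP.
move=> /sub_kermxP uB; apply: H => c cI.
by rewrite -(enum_rankK_in cI cI) -mul_colsub uB mxE.
Qed.

(** The vector [u] is the row belonging to [i] of the inverse of the submatrix on the columns in
    [I]. *)
Lemma pluecker_dual r W (I : {set 'I_n}) i : #|I| = r -> pluecker r W I != 0 ->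
  i \in I -> exists u : 'rV[K]_r,
    forall c, c \in I -> (u *m frame r W) 0 c = (c == i)%:R.
Proof.
move=> <-; rewrite plueckerE -unitfE -unitmxE => uB iI.
exists (delta_mx 0 (enum_rank_in iI i) *m
  invmx (colsub (@enum_val _ (mem I)) (frame #|I| W))) => c cI.
rewrite -{1}(enum_rankK_in iI cI) -mul_colsub mulmxKV // mxE eqxx /=.
by rewrite (can_in_eq (enum_rankK_in iI)).
Qed.

Definition pluecker_bases r W : {set {set 'I_n}} :=
  [set I : {set 'I_n} | (#|I| == r) && (pluecker r W I != 0)]%SET.

(** The frame has rank [r], so it has [r] independent columns, which [fullrankfun] selects as rows
    of the transpose. *)
Lemma pluecker_bases_neq0 r W : \dim W = r -> pluecker_bases r W != finset.set0.
Proof.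
move=> dW; have full : row_full (frame r W)^T.
  by rewrite /row_full mxrank_tr; exact: frame_row_free.
pose f := fullrankfun full; pose I := [set f j | j in 'I_r]%SET.
have cI : #|I| = r by rewrite card_imset ?card_ord //; exact: fullrankfun_inj.
apply/set0Pn; exists I; rewrite inE cI eqxx /=.
apply/(pluecker_neq0P _ cI) => u u0.
have fr : row_free (colsub f (frame r W)).
  by rewrite row_free_unit -unitmx_tr trmx_mxsub fullrowsub_unit.
apply: (row_free_inj fr); rewrite mul0mx; apply/rowP => j.
by rewrite mul_colsub u0 ?mxE ?imset_f.
Qed.

(** Take the combination [u] of the frame rows that is 1 at [i] and 0 on the rest of [I]. It is
    nonzero, so it cannot vanish on all of [J]; any [j] in [J] where it does not vanish can replace
    [i]. *)
Lemma pluecker_bases_exchange r W I J : I \in pluecker_bases r W ->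
  J \in pluecker_bases r W -> forall i, i \in (I :\: J)%SET ->
  exists2 j, j \in (J :\: I)%SET & (j |: (I :\ i))%SET \in pluecker_bases r W.
Proof.
rewrite !inE => /andP[/eqP cI pI] /andP[/eqP cJ /(pluecker_neq0P _ cJ) freeJ] i.
move=> /setDP[iI iJ]; have /(pluecker_neq0P _ cI) freeI := pI.
have [u uI] := pluecker_dual cI pI iI.
have u0 : u <> 0.
  by move=> E; have /eqP := uI _ iI; rewrite E mul0mx mxE eqxx eq_sym oner_eq0.
have [j jJ uj] : exists2 j, j \in J & (u *m frame r W) 0 j != 0.
  apply: contrapT => H; apply: u0; apply: freeJ => c cJc.
  by apply: contrapT => /eqP ?; apply: H; exists c.
have ji : j != i by apply: contraNneq iJ => <-.
have jI : j \notin I by apply: contra uj => /uI ->; rewrite (negPf ji).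
exists j; first by rewrite !inE jI.
have cI' : #|(j |: (I :\ i))%SET| = r.
  by rewrite cardsU1 !inE ji (negPf jI) -cI [in RHS](cardsD1 i) iI.
rewrite inE cI' eqxx /=; apply/(pluecker_neq0P _ cI') => v v0.
(* a vector annihilating the columns in [I :\ i] is a multiple of [u] *)
have vE : v = (v *m frame r W) 0 i *: u.
  apply/subr0_eq/freeI => c cIc; rewrite mulmxBl -scalemxAl.
  rewrite [LHS]mxE [X in _ + X]mxE [X in _ - X]mxE uI //.
  have [->|ci] := eqVneq c i; first by rewrite mulr1 subrr.
  by rewrite (v0 c) ?mulr0 ?subr0 // !inE ci cIc orbT.
have : (v *m frame r W) 0 j = 0 by apply: v0; rewrite !inE eqxx.
rewrite {1}vE -scalemxAl mxE => /eqP.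
by rewrite mulf_eq0 (negPf uj) orbF => /eqP vi0; rewrite vE vi0 scale0r.
Qed.

Lemma pluecker_bases_card r W I : I \in pluecker_bases r W -> #|I| = r.
Proof. by rewrite inE => /andP[/eqP]. Qed.

Definition pluecker_matroid r W (dW : \dim W = r) : matroid n r :=
  Matroid (pluecker_bases_neq0 dW)
    (@pluecker_bases_card r W)
    (@pluecker_bases_exchange r W).

End PlueckerMatroid.

(** * Generic thin cells and the preimage of an invariant point *)

Section Surjectivity.
Context (K : numClosedFieldType) (n k : nat) (d : 'I_k -> nat).
Local Notation flags := (flag_variety K n d).

Definition flag_matroid (W : flag K n d) : plurimatroid n d :=
  fun i => pluecker_matroid (step_dim W i).

Definition coord_neq0 v : set flags := [set W : flag K n d | flag_coord W v != 0].

Lemma coord_neq0_open v : open (coord_neq0 v).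
Proof.
exists [set fun W => flag_coord W v]; split.
  move=> _ ->; exists (flag_degree v); exists (mpolyX K (mnm1 v)).
    move=> m; rewrite msuppX inE => /eqP -> i.
    rewrite (bigD1 v) //= big1 ?addn0 ?mnm1E ?eqxx ?mul1n // => u uv.
    by rewrite mnm1E eq_sym (negPf uv).
  by move=> W; rewrite mevalXU.
rewrite eqEsubset; split => W /=.
  by move=> /eqP nW /(_ _ erefl).
by move=> nW; apply/eqP => E; apply: nW => _ ->.
Qed.

Lemma thin_cell_flag_matroid (W W' : flag K n d) :
  (forall v, flag_coord W v != 0 <-> flag_coord W' v != 0) ->
  thin_cell (flag_matroid W') W.
Proof.
move=> H i I /eqP cI; rewrite inE cI /=.
have := H (enum_rank (Tagged (fun i => {I : {set 'I_n} | #|I| == d i})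
  (exist (fun I : {set 'I_n} => #|I| == d i) I cI) : pluecker_var n d)).
by rewrite /flag_coord enum_rankK.
Qed.

Lemma generic_thin_cell_dense (Z : set flags) : irreducible Z ->
  exists2 W, Z W & Z `<=` closure (Z `&` thin_cell (flag_matroid W)).
Proof.
move=> irrZ; pose s := [seq v <- enum 'I__ | `[< Z `&` coord_neq0 v !=set0 >]].
pose U := \bigcap_(v in [set` s]) coord_neq0 v.
have [|oU ZU] := @irreducible_meet_bigcap _ Z _ s coord_neq0 irrZ.
  move=> v; rewrite mem_filter => /andP[/asboolP ZV _].
  by split => //; exact: coord_neq0_open.
(* All points of [Z] in [U] have the same nonvanishing coordinates, hence lie in one thin cell. *)
have UP W : Z W -> U W -> forall v, flag_coord W v != 0 <-> v \in s.
  move=> ZW UW v; split; last exact: UW.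
  move=> Wv; rewrite mem_filter mem_enum andbT.
  by apply/asboolP; exists W.
have [W [ZW UW]] := ZU; exists W => //.
apply: (subset_trans (irreducible_dense_open irrZ oU ZU)).
apply: closure_subset => W' [ZW' UW']; split => //.
by apply: thin_cell_flag_matroid => v; rewrite (UP W') // (UP W).
Qed.

Lemma V_union_surj (F : forall M, quotient_data (@quotient_torus_act K n k d M))
  (eta : @invariant_points K n k d) : exists y, V_union F y = eta.
Proof.
pose Z := locus (val eta).
(* The invariance condition is applied to [val eta] itself, which lies in its own closure. *)
have invZ W g : Z W -> Z (flag_act W g).
  have /set_mem /(_ g (val eta)) := valP eta.
  rewrite closure_spoint1 => /(_ (@subset_refl _ _)) H ZW.
  by apply: H; apply: subset_closure; exists W.
have irrZ := locus_irreducible (val eta).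
have [W ZW dense] := generic_thin_cell_dense irrZ.
set M := flag_matroid W in dense.
pose A : set (thin_cell_variety K M) := val @^-1` Z.
have irrA : irreducible A by exact: subspace_irreducible.
have cA : closed A.
  apply: (proj1 (continuous_closedP _) (@thin_cell_incl_continuous _ _ _ _ _)).
  exact: locus_closed.
pose Y := quot_map (F M) @` A.
have [[_ _ [_ fib] sub _] _] := quot_universal (F M).
(* Fibres of the quotient map are orbits and [A] is invariant, so [A] is saturated; since the map is
   submersive, [Y] is then closed. *)
have preY : quot_map (F M) @^-1` Y = A.
  rewrite eqEsubset; split => x; last by exists x.
  move=> [x' Ax' /fib [c ->]].
  by rewrite /A /preimage /= /quotient_torus_act; exact: invZ.
have cY : closed Y.
  by rewrite -openC; apply/sub; rewrite -preimage_setC preY openC.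
have irrY : irreducible Y.
  by apply: irreducible_image => //; exact: quot_map_continuous.
exists (existT _ M (spoint_of cY irrY)).
(* Points with equal closures agree, and the closure of the image is given by the defining property
   of [V_map]. *)
apply: val_inj; apply: closure_spoint1_inj.
rewrite /V_union /V_map /=; case: cid => eta' /= ->.
rewrite closure_spoint [RHS]closure_spoint1.
set C := closure (\bigcup_(z in _) locus z); suff -> : C = Z by [].
rewrite {}/C eqEsubset; split.
  apply: closure_min; last exact: locus_closed.
  move=> x [_ [zeta + <-]]; rewrite /preimage /= closure_spoint1 /= => zetaY.
  move: x; apply: (@closure_min _ (val @` locus zeta)); last exact: locus_closed.
  move=> _ [x zx <-]; suff : A x by [].
  by rewrite -preY; apply: zetaY; apply: subset_closure; exists x.
apply: (subset_trans dense); apply: closure_subset => x [Zx Mx].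
(* The generic point of [A] maps into the closure of the chosen point of the quotient, and its locus
   in the flag variety contains every flag of [Z] in the cell. *)
exists (spoint_map (@thin_cell_incl_continuous K n k d M) (spoint_of cA irrA)).
  exists (spoint_of cA irrA) => //; rewrite /preimage /= closure_spoint1 /=.
  exact: closure_min.
by apply: subset_closure; exists (set_elt Mx).
Qed.

End Surjectivity.

Theorem theorem4p6 (R : realType) (n k : nat) (d : 'I_k -> nat)
    (k_gt0 : (0 < k)%N)
    (d_gt0 : forall i, (0 < d i)%N)
    (d_incr : forall i j : 'I_k, (i < j)%N -> (d i < d j)%N)
    (d_ltn : forall i, (d i < n)%N)
    (F : forall M : plurimatroid n d,
      quotient_data (@quotient_torus_act R[i] n k d M)) :
  set_surj [set: {M : plurimatroid n d & spoint (F M)}]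
           [set: @invariant_points R[i] n k d]
           (V_union F).
Proof.
move=> eta _; have [y <-] := V_union_surj F eta.
by exists y.
Qed.
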